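(* Let $(P,\leq_P,\preceq_P)$ be an ordered forest, and write $\max(P,\leq_P)=\{m_0,\dots,m_r\}$ for its set of $\leq_P$-maximal elements, with $m_0\preceq_P\cdots\preceq_P m_r$. Set $T_i:=L_P(m_i)=\{y\in P\mid y\leq_P m_i\}$, with the orders induced from $P$. Then: (i) each $T_i$ is an ordered tree; (ii) the sets $T_0,\dots,T_r$ are pairwise disjoint; (iii) $P=\bigcup_{i=0}^r T_i$; (iv) each $T_i$ is an interval in $(P,\preceq_P)$; (v) $P$ is canonically isomorphic (via the inclusions $T_i\subseteq P$) to the ordered disjoint union $T_0\oplus\cdots\oplus T_r$. In particular, every ordered forest decomposes canonically into an ordered disjoint union of ordered trees.
   Context: An ordered quiver is a triple $(P,\leq_P,\preceq_P)$ consisting of a finite set $P$, a partial order $\leq_P$ and a total order $\preceq_P$ on $P$ such that $x\leq_P y$ implies $x\preceq_P y$. A morphism of ordered quivers is a set map preserving both orders; isomorphisms are taken in the resulting category $\mathbf{Quiv}$. For $x\in P$ put $L_P(x)=\{y\in P\mid y\leq_P x\}$. A subset $I$ of a poset $(Q,\leq)$ is an interval if for all $a\leq b$ in $I$, every $c\in Q$ with $a\leq c\leq b$ lies in $I$. An ordered forest is an ordered quiver $(P,\leq_P,\preceq_P)$ such that $L_P(x)$ is an interval in $(P,\preceq_P)$ for every $x\in P$. An ordered tree is an ordered forest whose partial order has a unique maximal element. The ordered disjoint union $T_0\oplus\cdots\oplus T_r$ of ordered quivers is the disjoint union of the underlying sets, with partial order the disjoint union of the partial orders (elements of distinct $T_i,T_j$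 are incomparable) and total order the ordinal sum of the total orders (all elements of $T_i$ precede all elements of $T_j$ when $i<j$). *)

(* Defs.v *)
From HB Require Import structures.
From mathcomp Require Import all_boot.

Set Implicit Arguments.
Unset Strict Implicit.
Unset Printing Implicit Defensive.

Record ordered_quiver := OrderedQuiver {
  quiv_carrier :> finType;
  ple : rel quiv_carrier;
  tle : rel quiv_carrier;
  ple_refl : reflexive ple;
  ple_anti : antisymmetric ple;
  ple_trans : transitive ple;
  tle_anti : antisymmetric tle;
  tle_trans : transitive tle;
  tle_total : total tle;
  ple_tle : forall x y, ple x y -> tle x y
}.

Arguments ple {o} x y.
Arguments tle {o} x y.

Definition quiv_morphism (P Q : ordered_quiver) (f : P -> Q) : Prop :=
  {homo f : x y / ple x y} /\ {homo f : x y / tle x y}.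

Definition quiv_iso (P Q : ordered_quiver) (f : P -> Q) : Prop :=
  quiv_morphism f /\
  exists g : Q -> P, [/\ quiv_morphism g, cancel f g & cancel g f].

Definition lower (P : ordered_quiver) (x : P) : {set P} := [set y | ple y x].

Definition is_interval (T : finType) (le : rel T) (I : {set T}) : Prop :=
  forall a b, a \in I -> b \in I -> le a b ->
  forall c, le a c -> le c b -> c \in I.

Definition maximals (P : ordered_quiver) : {set P} :=
  [set x | [forall y, ple x y ==> (y == x)]].

Definition ordered_forest (P : ordered_quiver) : Prop :=
  forall x : P, is_interval tle (lower x).

Definition ordered_tree (P : ordered_quiver) : Prop :=
  ordered_forest P /\ exists! m : P, m \in maximals P.

Section SubQuiver.
Variables (P : ordered_quiver) (S : {set P}).

Let T : finType := {x : P | x \in S}.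
Let sub_ple : rel T := fun x y => ple (val x) (val y).
Let sub_tle : rel T := fun x y => tle (val x) (val y).

Fact sub_ple_refl : reflexive sub_ple.
Proof. by move=> x; apply: ple_refl. Qed.

Fact sub_ple_anti : antisymmetric sub_ple.
Proof. by move=> x y /ple_anti /val_inj. Qed.

Fact sub_ple_trans : transitive sub_ple.
Proof. by move=> y x z; apply: ple_trans. Qed.

Fact sub_tle_anti : antisymmetric sub_tle.
Proof. by move=> x y /tle_anti /val_inj. Qed.

Fact sub_tle_trans : transitive sub_tle.
Proof. by move=> y x z; apply: tle_trans. Qed.

Fact sub_tle_total : total sub_tle.
Proof. by move=> x y; apply: tle_total. Qed.

Fact sub_ple_tle x y : sub_ple x y -> sub_tle x y.
Proof. exact: ple_tle. Qed.

Definition sub_quiver : ordered_quiver :=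
  OrderedQuiver sub_ple_refl sub_ple_anti sub_ple_trans
    sub_tle_anti sub_tle_trans sub_tle_total sub_ple_tle.

End SubQuiver.

Section OrderedDisjointUnion.
Variables (n : nat) (T : 'I_n -> ordered_quiver).

Let U : finType := {i : 'I_n & T i}.

(* [tagged_as u v] is the second component of [v], transported to the summand
   of [u]; it is only meaningful under the guard [tag u == tag v]. *)
Let sum_ple : rel U := fun u v =>
  (tag u == tag v) && ple (tagged u) (tagged_as u v).
Let sum_tle : rel U := fun u v =>
  (tag u < tag v) || (tag u == tag v) && tle (tagged u) (tagged_as u v).

Fact sum_ple_refl : reflexive sum_ple.
Proof. by case=> i x; rewrite /sum_ple eqxx tagged_asE ple_refl. Qed.

Fact sum_ple_anti : antisymmetric sum_ple.
Proof.
move=> [i x] [j y]; rewrite /sum_ple /= => /andP[/andP[/eqP ij]].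
case: j / ij y => y; rewrite !tagged_asE eqxx /= => xy yx.
by congr existT; apply: ple_anti; rewrite xy yx.
Qed.

Fact sum_ple_trans : transitive sum_ple.
Proof.
move=> [j y] [i x] [k z]; rewrite /sum_ple /= => /andP[/eqP ij].
case: j / ij y => y; rewrite tagged_asE => xy /andP[/eqP ik].
case: k / ik z => z; rewrite !tagged_asE eqxx /=.
exact: ple_trans.
Qed.

Fact sum_tle_anti : antisymmetric sum_tle.
Proof.
move=> [i x] [j y]; rewrite /sum_tle /=.
case: (ltngtP i j) => //=; first by move=> ij; rewrite eq_sym -val_eqE ltn_eqF.
  by move=> ji; rewrite -val_eqE gtn_eqF.
move=> /val_inj ij; case: j / ij y => y; rewrite !tagged_asE eqxx /=.
by move=> xy; congr existT; apply: tle_anti.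
Qed.

Fact sum_tle_trans : transitive sum_tle.
Proof.
move=> [j y] [i x] [k z]; rewrite /sum_tle /=.
case/orP=> [ij|/andP[/eqP ij]].
  case/orP=> [jk|/andP[/eqP jk _]]; first by rewrite (ltn_trans ij jk).
  by case: k / jk z => z; rewrite ij.
case: j / ij y => y; rewrite tagged_asE => xy.
case/orP=> [ik|/andP[/eqP ik]]; first by apply/orP; left.
case: k / ik z => z; rewrite !tagged_asE eqxx ltnn /=.
exact: tle_trans.
Qed.

Fact sum_tle_total : total sum_tle.
Proof.
move=> [i x] [j y]; rewrite /sum_tle /=.
case: (ltngtP i j) => [//||/val_inj ij]; first by rewrite orbT.
by case: j / ij y => y; rewrite !tagged_asE eqxx /= tle_total.
Qed.

Fact sum_ple_tle u v : sum_ple u v -> sum_tle u v.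
Proof.
by rewrite /sum_ple /sum_tle => /andP[-> /ple_tle ->]; rewrite orbT.
Qed.

Definition ordered_union : ordered_quiver :=
  OrderedQuiver sum_ple_refl sum_ple_anti sum_ple_trans
    sum_tle_anti sum_tle_trans sum_tle_total sum_ple_tle.

End OrderedDisjointUnion.

Definition union_inclusion (P : ordered_quiver) (n : nat) (S : 'I_n -> {set P})
    (u : ordered_union (fun i => sub_quiver (S i))) : P :=
  val (tagged u).

(* The empty forest is not excluded: it has [n = 0] maximal elements. *)
Definition enumerates_maximals (P : ordered_quiver) (n : nat) (m : 'I_n -> P)
    : Prop :=
  [/\ injective m,
      [set m i | i : 'I_n] = maximals P
    & forall i j : 'I_n, i <= j -> tle (m i) (m j)].

(* Main.v *)
(** If [y] lies below two maximal elements [m], [m'] with [m] before [m'] in the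
    total order, then [m] sits between [y] and [m'], hence in the interval
    [lower m'], so [m = m']: the trees are disjoint.  Likewise, if [x] in
    [lower m] came after [y] in [lower m'], then [x] would sit between [y] and
    [m'], hence in both trees; so the trees follow one another in the total
    order. *)
Require Import Defs.
From HB Require Import structures.
From mathcomp Require Import all_boot.

Set Implicit Arguments.
Unset Strict Implicit.
Unset Printing Implicit Defensive.

Section OrderedQuivers.
Variable P : ordered_quiver.
Implicit Types (x y z m : P) (S : {set P}).

Lemma mem_lower x y : (y \in lower x) = ple y x.
Proof. by rewrite inE. Qed.

Lemma lower_id x : x \in lower x.
Proof. by rewrite mem_lower ple_refl. Qed.

Lemma maximalP x : reflect (forall y, ple x y -> y = x) (x \in maximals P).
Proof.
rewrite inE; apply: (iffP forallP) => [xmax y xy|xmax y].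
  by apply/eqP; move/implyP: (xmax y); apply.
by apply/implyP => /xmax ->.
Qed.

(** Finiteness gives an element [m] above [x] whose lower set has the most elements. Anything
    strictly above [m] would have a strictly larger lower set. *)
Lemma exists_maximal x : exists2 m, m \in maximals P & ple x m.
Proof.
case: (arg_maxnP (fun y => #|lower y|) (ple_refl x)) => m xm m_max.
exists m => //; apply/maximalP => y my; apply/eqP; apply: contraT => y'm.
suff /proper_card : lower m \proper lower y.
  by rewrite ltnNge => /negP[]; apply: m_max; apply: ple_trans my.
apply/properP; split.
  by apply/subsetP => z; rewrite !mem_lower => /ple_trans; apply.
exists y; rewrite ?lower_id // mem_lower; apply: contra y'm => ym.
by apply/eqP/ple_anti; rewrite ym.
Qed.

Lemma sub_quiver_forest S : ordered_forest P -> ordered_forest (sub_quiver S).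
Proof.
move=> HP x a b; rewrite !inE => ax bx ab c ac cb.
have := HP (val x) (val a) (val b); rewrite !mem_lower.
by move=> /(_ ax bx ab (val c) ac cb); rewrite !inE.
Qed.

(** The forest condition passes to any subset, and [x] is the greatest element of [lower x], hence
    its only maximal one. *)
Lemma lower_tree x : ordered_forest P -> ordered_tree (sub_quiver (lower x)).
Proof.
move=> HP; split; first exact: sub_quiver_forest.
pose x0 : sub_quiver (lower x) := Sub x (lower_id x).
have le_x0 (y : sub_quiver (lower x)) : ple y x0.
  by have := valP y; rewrite mem_lower.
exists x0; split.
  by rewrite inE; apply/forallP => y; apply/implyP => x0y;
     apply/eqP/ple_anti; rewrite x0y le_x0.
by move=> y; rewrite inE => /forallP/(_ x0)/implyP/(_ (le_x0 y))/eqP.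
Qed.

Lemma lower_maximal_disjoint m m' : ordered_forest P ->
  m \in maximals P -> m' \in maximals P -> m != m' ->
  [disjoint lower m & lower m'].
Proof.
move=> HP; wlog mm' : m m' / tle m m' => [IH|/maximalP m_max _ neq].
  move=> Mm Mm' neq; case/orP: (tle_total m m') => le; first exact: IH.
  by rewrite disjoint_sym; apply: IH; rewrite // eq_sym.
apply/pred0P => y /=; apply/negP => /andP[]; rewrite mem_lower => ym ym'.
have := HP m' y m' ym' (lower_id _) _ m (ple_tle ym) mm'.
rewrite mem_lower in ym'; rewrite mem_lower => /(_ (ple_tle ym'))/m_max m'm.
by rewrite m'm eqxx in neq.
Qed.

Lemma lower_maximal_tle m m' x y : ordered_forest P ->
  m \in maximals P -> m' \in maximals P -> m != m' -> tle m m' ->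
  x \in lower m -> y \in lower m' -> tle x y.
Proof.
move=> HP Mm Mm' neq mm' xm ym'; case/orP: (tle_total x y) => // yx.
have xm' : tle x m'.
  by apply: tle_trans mm'; apply: ple_tle; rewrite -mem_lower.
have := HP m' y m' ym' (lower_id _) (tle_trans yx xm') x yx xm'.
by rewrite (disjointFr (lower_maximal_disjoint HP Mm Mm' neq) xm).
Qed.

Lemma exists_enumerates_maximals :
  exists n, exists m : 'I_n -> P, enumerates_maximals m.
Proof.
pose s := sort tle (enum (maximals P)).
exists (size s), (tnth (in_tuple s)); split.
- by apply/tuple_uniqP; rewrite sort_uniq enum_uniq.
- apply/setP => x; rewrite -[in RHS]mem_enum -(mem_sort tle).
  apply/imsetP/idP => [[i _ ->]|]; first exact: (mem_tnth i (in_tuple s)).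
  by case/(tnthP (in_tuple s)) => i ->; exists i.
(* [x0] only serves as the default value of [nth]; the index [i] shows that [P] is inhabited. *)
move=> i j ij; have x0 := tnth (in_tuple s) i; rewrite !(tnth_nth x0).
apply: (sorted_leq_nth (@tle_trans P)); rewrite ?inE ?ltn_ord //.
- by move=> x; have := tle_total x x; rewrite orbb.
- by apply: sort_sorted; apply: tle_total.
Qed.

Section Decomposition.
Variables (n : nat) (m : 'I_n -> P).
Hypotheses (HP : ordered_forest P) (Em : enumerates_maximals m).
Let T i := lower (m i).

Lemma enum_maximal i : m i \in maximals P.
Proof. by have [_ <- _] := Em; rewrite imset_f. Qed.

Lemma enum_lower_disjoint i j : i != j -> [disjoint T i & T j].
Proof.
move=> ij; have [m_inj _ _] := Em.
by apply: lower_maximal_disjoint; rewrite ?enum_maximal ?(inj_eq m_inj).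
Qed.

Lemma enum_lower_cover : [set: P] = \bigcup_(i < n) T i.
Proof.
apply/esym/setP => x; rewrite in_setT; apply/bigcupP.
have [y] := exists_maximal x; have [_ <- _] := Em.
by case/imsetP => i _ -> xi; exists i; rewrite // mem_lower.
Qed.

(** This form of disjointness yields the equality of tags along which elements of the union are
    transported. *)
Lemma enum_lower_tag i j x : x \in T i -> x \in T j -> i = j.
Proof.
move=> xi xj; apply/eqP; apply: contraLR xj => /enum_lower_disjoint dij.
by rewrite (disjointFr dij xi).
Qed.

Lemma union_inclusion_iso : quiv_iso (@union_inclusion P n T).
Proof.
set f := @union_inclusion P n T.
have fT u : f u \in T (tag u) by apply: valP.
have f_ple : {homo f : u v / ple u v}.
  move=> [i x] [j y]; rewrite /ple /= => /andP[/eqP ij].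
  by case: j / ij y => y; rewrite tagged_asE.
have f_tle : {homo f : u v / tle u v}.
  move=> u v; have := fT v; have := fT u; case: u v => [i x] [j y] fx fy.
  have [m_inj _ m_tle] := Em.
  rewrite {1}/tle /= => /orP[ij|/andP[/eqP ij]].
    (* Across distinct summands, the order of the indices is that of the maximal elements, and whole
       trees follow it. *)
    apply: lower_maximal_tle HP (enum_maximal i) (enum_maximal j) _ _ fx fy.
      by rewrite (inj_eq m_inj) -val_eqE ltn_eqF.
    by apply: m_tle; apply: ltnW.
  by case: j / ij y {fy} => y; rewrite tagged_asE.
have f_inj : injective f.
  move=> u v; have := fT v; have := fT u; case: u v => [i x] [j y] fx fy fxy.
  rewrite -fxy in fy; have /= ij := enum_lower_tag fx fy.
  by case: j / ij y {fy} fxy => y fxy; congr existT; apply: val_inj.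
(* The trees cover [P], so [f] is surjective; choice over a finite type turns this into a right
   inverse. *)
have /fin_all_exists[g gK] x : exists u, f u = x.
  have := in_setT x; rewrite enum_lower_cover => /bigcupP[i _ xi].
  by exists (Tagged (fun i => sub_quiver (T i)) (Sub x xi : sub_quiver (T i))).
have fK : cancel f g by move=> u; apply: f_inj; rewrite gK.
(* Writing [x] and [y] as images under [f], monotonicity of [g] becomes the claim that [f] reflects
   both orders. *)
split=> //; exists g; split=> //; split=> x y; rewrite -{1}[x]gK -{1}[y]gK.
  move: (g x) (g y) => u v uv.
  (* Lower sets are downward closed, so [f u] also lies in the tree of [f v]. *)
  have tuv : tag u = tag v.
    apply: enum_lower_tag (fT u) _; rewrite mem_lower.
    by apply: ple_trans uv _; rewrite -mem_lower fT.
  case: u v tuv uv => [i a] [j b] /= ij; case: j / ij b => b ab.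
  by rewrite /ple /= eqxx tagged_asE.
(* A monotone injection between total orders reflects them: if [v] precedes [u], antisymmetry forces
   [f u = f v]. *)
move: (g x) (g y) => u v uv; case/orP: (tle_total u v) => // vu.
suff <- : v = u by have := tle_total v v; rewrite orbb.
by apply/f_inj/tle_anti; rewrite uv f_tle.
Qed.

End Decomposition.
End OrderedQuivers.

Theorem theorem1p3 (P : ordered_quiver) (HP : ordered_forest P) :
  (forall (n : nat) (m : 'I_n -> P), enumerates_maximals m ->
     let T := fun i : 'I_n => lower (m i) in
     [/\ forall i, ordered_tree (sub_quiver (T i)),
         forall i j, i != j -> [disjoint T i & T j],
         [set: P] = \bigcup_(i < n) T i,
         forall i, is_interval tle (T i)
       & quiv_iso (@union_inclusion P n T)]) /\
  (exists (n : nat) (m : 'I_n -> P),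
     let T := fun i : 'I_n => lower (m i) in
     [/\ enumerates_maximals m,
         forall i, ordered_tree (sub_quiver (T i))
       & quiv_iso (@union_inclusion P n T)]).
Proof.
split=> [n m Em T|].
  split.
  - by move=> i; apply: lower_tree.
  - exact: enum_lower_disjoint.
  - exact: enum_lower_cover.
  - by move=> i; apply: HP.
  - exact: union_inclusion_iso.
have [n [m Em]] := exists_enumerates_maximals P.
exists n, m; split=> //; first by move=> i; apply: lower_tree.
exact: union_inclusion_iso.
Qed.
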